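(* Let $A$ be an $n\times n$ oscillatory matrix, let $1\le k<n$, and abbreviate $\lambda_k=\lambda_k(A)$, $\rho_k=\rho_k(A)$. Then $$e_k(A)=\tau_k(A)=\max\Bigl\{\min\{m\ge1:\rho_k^m(L_k)=R_k\},\ \min\{m\ge1:\lambda_k^m(R_k)=L_k\}\Bigr\}.$$ More generally, for $k$-subsets $I,J$ of $[n]$, the least nonnegative integer $m$ for which the $(I,J)$-minor of $A^m$ is positive is $$\min\{m\ge0:\lambda_k^m(I)\preceq J\preceq\rho_k^m(I)\}.$$ The largest of these hitting times over all pairs $(I,J)$ of $k$-subsets is attained by one of the pairs $(L_k,R_k)$ and $(R_k,L_k)$, and equals $e_k(A)$.
   Context: All matrices are real and have order $n\ge2$. A matrix is totally nonnegative (TN) if all its minors are $\ge0$ and totally positive (TP) if all its minors are $>0$; a square TN matrix is oscillatory if some positive power of it is TP. $\Delta_{I,J}(A)=\det A[I,J]$ is the minor with row set $I$ and column set $J$. $[n]=\{1,\dots,n\}$, $L_k=\{1,\dots,k\}$, $R_k=\{n-k+1,\dots,n\}$. $e_k(A)=\min\{m\ge1:\text{all }k\text{-minors of }A^m\text{ are positive}\}$. The corner thresholds are $\tau_k^{\mathrm{UR}}(A)=\min\{m\ge1:\Delta_{L_k,R_k}(A^m)>0\}$, $\tau_k^{\mathrm{LL}}(A)=\min\{m\ge1:\Delta_{R_k,L_k}(A^m)>0\}$, and $\tau_k(A)=\max\{\tau_k^{\mathrm{UR}}(A),\tau_k^{\mathrm{LL}}(A)\}$ (all finite, since a high power of $A$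 is TP). For $k$-subsets $I=\{i_1<\dots<i_k\}$, $J=\{j_1<\dots<j_k\}$ of $[n]$, $I\preceq J$ means $i_r\le j_r$ for all $r$. For a nonsingular TN matrix $A$ and a $k$-subset $I$, the set $\{J:\Delta_{I,J}(A)>0\}$ has a least and a greatest element with respect to $\preceq$; these are denoted $\lambda_k(A)(I)$ and $\rho_k(A)(I)$ respectively, which defines maps $\lambda_k(A),\rho_k(A)$ from the $k$-subsets of $[n]$ to themselves. (Oscillatory matrices are nonsingular.) Powers $\lambda_k^m,\rho_k^m$ denote $m$-fold composition, with the $0$-th power being the identity, and $A^0$ is the identity matrix. *)

(* Defs.v *)
From HB Require Import structures.
From mathcomp Require Import all_boot all_order all_algebra.
From mathcomp Require Import reals.

Set Implicit Arguments.
Unset Strict Implicit.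
Unset Printing Implicit Defensive.

Import Order.TTheory GRing.Theory Num.Theory.
Local Open Scope ring_scope.

(* The index set [n] = {1, ..., n} is rendered 0-based, as 'I_n. *)

Definition is_min (P : nat -> Prop) (m : nat) : Prop :=
  P m /\ forall j : nat, P j -> (m <= j)%N.

Section KSubsets.
Variables n k : nat.

Definition ksubset : Type := {I : {set 'I_n} | #|I| == k}.

(* enum_val lists a set of ordinals in increasing order, so [elem I] is the
   increasing enumeration i_1 < ... < i_k of I. *)
Definition elem (I : ksubset) (r : 'I_k) : 'I_n :=
  enum_val (cast_ord (esym (eqP (valP I))) r).

Definition kle (I J : ksubset) : bool := [forall r : 'I_k, (elem I r <= elem J r)%N].

Lemma card_left (kn : (k <= n)%N) : #|[set i : 'I_n | (i < k)%N]| == k.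
Proof.
have -> : [set i : 'I_n | (i < k)%N] = [set widen_ord kn j | j : 'I_k].
  apply/setP => i; rewrite inE; apply/idP/imsetP => [ik|[j _ ->]] //=.
  by exists (Ordinal ik) => //; apply: val_inj.
rewrite card_imset ?card_ord // => i j /(congr1 val) /= ij; exact: val_inj.
Qed.

Lemma card_right (kn : (k <= n)%N) : #|[set i : 'I_n | (n - k <= i)%N]| == k.
Proof.
have -> : [set i : 'I_n | (n - k <= i)%N] =
          [set rev_ord j | j in [set i : 'I_n | (i < k)%N]].
  apply/setP => i; rewrite inE; apply/idP/imsetP => [ik|[j]].
    exists (rev_ord i); last by rewrite rev_ordK.
    by rewrite inE /= ltn_subLR ?ltn_ord // addSn ltnS addnC -leq_subLR.
  by rewrite inE => jk -> /=; rewrite leq_sub2l.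
by rewrite card_imset ?card_left //; apply: rev_ord_inj.
Qed.

Definition Lset (kn : (k <= n)%N) : ksubset := exist _ [set i : 'I_n | (i < k)%N] (card_left kn).
Definition Rset (kn : (k <= n)%N) : ksubset := exist _ [set i : 'I_n | (n - k <= i)%N] (card_right kn).

End KSubsets.

Section TotalPositivity.
Variables (R : realType) (n : nat).
Implicit Type A : 'M[R]_n.

Definition minor k (I J : ksubset n k) A : R := \det (mxsub (elem I) (elem J) A).

(* The order k = 0 is harmless here: the empty minor is 1. *)
Definition totally_nonnegative A : Prop :=
  forall k (I J : ksubset n k), 0 <= minor I J A.

Definition totally_positive A : Prop :=
  forall k (I J : ksubset n k), 0 < minor I J A.

Definition oscillatory A : Prop :=
  totally_nonnegative A /\ exists m : nat, (0 < m)%N /\ totally_positive (A ^+ m).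

(* lambda A I and rho A I are the least and the greatest element, for kle, of
   {J | 0 < minor I J A}.  These exist when A is totally nonnegative and
   nonsingular; otherwise the value defaults to I. *)
Definition lambda A k (I : ksubset n k) : ksubset n k :=
  odflt I [pick J | (0 < minor I J A) &&
                    [forall J', (0 < minor I J' A) ==> kle J J']].

Definition rho A k (I : ksubset n k) : ksubset n k :=
  odflt I [pick J | (0 < minor I J A) &&
                    [forall J', (0 < minor I J' A) ==> kle J' J]].

(* The minima e_k, tau_k^UR and tau_k^LL are given as relations, so that
   asserting a value includes asserting that the minimum exists. *)
Definition is_exponent k A (e : nat) : Prop :=
  is_min (fun m => (1 <= m)%N /\ forall I J : ksubset n k, 0 < minor I J (A ^+ m)) e.

Definition is_tauUR k (kn : (k <= n)%N) A (t : nat) : Prop :=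
  is_min (fun m => (1 <= m)%N /\ 0 < minor (Lset kn) (Rset kn) (A ^+ m)) t.

Definition is_tauLL k (kn : (k <= n)%N) A (t : nat) : Prop :=
  is_min (fun m => (1 <= m)%N /\ 0 < minor (Rset kn) (Lset kn) (A ^+ m)) t.

Definition is_tau k (kn : (k <= n)%N) A (t : nat) : Prop :=
  exists u l : nat, [/\ is_tauUR kn A u, is_tauLL kn A l & t = maxn u l].

End TotalPositivity.

(* Main.v *)
Require Import Defs.
From HB Require Import structures.
From mathcomp Require Import all_boot all_order all_algebra.
From mathcomp Require Import reals perm zify.

Set Implicit Arguments.
Unset Strict Implicit.
Unset Printing Implicit Defensive.

Import Order.TTheory GRing.Theory Num.Theory.
Local Open Scope ring_scope.

(** For a nonsingular totally nonnegative matrix [A] and a k-subset [I], the set of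
    the [J] with a positive [(I, J)]-minor is not only bounded by [lambda I] and
    [rho I]: it is the whole order interval between them, and [lambda] and [rho]
    are monotone. Moreover these maps compose under matrix
    multiplication, so that the [(I, J)]-minor of [A ^+ m] is positive exactly
    when [J] lies between [iter m lambda I] and [iter m rho I] ([minor_exp]).
    Everything claimed about hitting times follows. The [lambda]-orbit of [I]
    decreases and its [rho]-orbit increases, so a minor that becomes positive
    stays positive. By monotonicity, once the [rho]-orbit of the least subset
    [Lk] has reached the greatest subset [Rk], so has that of every [I], and
    dually; hence all k-minors are positive as soon as the two corner minors are.

    The interval property and the composition rule are proved together, by
    factoring [A] into bidiagonal matrices. Multiplying on the right by a shear
    [1 + t E_(b,b+1)] with [t > 0] leaves the [(I, J)]-minor unchanged
    unless [J] contains [b+1] but not [b], and then adds to it [t] times the minor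
    obtained by moving [b+1] down to [b] in [J]. On supports, this
    turns an interval [[L, M]] into [[L, up M]], where [up] moves [b] up to [b+1]
    when that is possible ([up_interval]); lower shears are the mirror image under
    the reversal of [n], and positive diagonal matrices change no support.

    That every nonsingular totally nonnegative matrix is a product of such factors
    (the theorem of Loewner and Whitney) is proved by induction on the number of
    positive minors. One divides by the shear with the largest [t] that keeps all
    minors nonnegative; this kills at least one positive minor
    ([shear_reduction]). The step needs [t > 0], and this is the content of
    [pivot_column]: if the matrix is not lower triangular and [(i0, c)] is the last
    nonzero entry of the first row having one above the diagonal, then no minor
    using column [c] vanishes when the same minor with the column before [c] in
    its place is positive. A matrix with nothing left to divide out on either side
    of the diagonal is a positive diagonal matrix. *)

(** * k-subsets as increasing sequences *)

Definition increasing k n (f : 'I_k -> 'I_n) : Prop :=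
  forall i j : 'I_k, (i < j)%N -> (f i < f j)%N.

Lemma increasing_lt k n (f : 'I_k -> 'I_n) (i j : 'I_k) :
  increasing f -> (f i < f j)%N = (i < j)%N.
Proof.
move=> hf; apply/idP/idP => [|/hf//].
by apply: contraTltn; rewrite leq_eqVlt => /orP[/eqP/val_inj->|/hf/ltnW]; rewrite -leqNgt.
Qed.

Lemma increasing_inj k n (f : 'I_k -> 'I_n) : increasing f -> injective f.
Proof.
move=> hf i j e; apply: val_inj.
have := increasing_lt i j hf; have := increasing_lt j i hf.
by rewrite e ltnn; case: ltngtP.
Qed.

Lemma increasing_comp k m n (f : 'I_m -> 'I_n) (g : 'I_k -> 'I_m) :
  increasing f -> increasing g -> increasing (f \o g).
Proof. by move=> hf hg i j /hg /hf. Qed.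

Lemma increasing_lift k (i : 'I_k) : increasing (lift i).
Proof. by move=> a b ab; rewrite /= /bump; lia. Qed.

Lemma const_increasing n (x : 'I_n) : increasing (fun _ : 'I_1 => x).
Proof. by move=> i j; rewrite !ord1. Qed.

Section Coordinates.
Variables n k : nat.
Implicit Types I J K : ksubset n k.

Lemma elem_increasing I : increasing (elem I).
Proof.
move=> i j ij; rewrite /elem !(enum_val_nth (elem I i)) /=.
set s := enum _.
have ss : sorted ltn (map val s).
  rewrite /s -[enum _](eq_filter (mem_enum _)).
  rewrite -(eq_filter (mem_map val_inj _)) -filter_map.
  by rewrite (sorted_filter ltn_trans) // unlock val_ord_enum iota_ltn_sorted.
have sz : size s = k by rewrite /s -cardE (eqP (valP I)).
have := sorted_ltn_nth ltn_trans 0%N ss; move/(_ i j).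
by rewrite !inE !size_map sz !ltn_ord !(nth_map (elem I i)) ?sz ?ltn_ord //; apply.
Qed.

Lemma increasing_card (f : 'I_k -> 'I_n) :
  increasing f -> #|[set f i | i in 'I_k]| == k.
Proof. by move=> hf; rewrite card_imset ?card_ord //; exact: increasing_inj. Qed.

Definition of_increasing (f : 'I_k -> 'I_n) (hf : increasing f) : ksubset n k :=
  exist _ [set f i | i in 'I_k] (increasing_card hf).

(** The sequence of values is a sorted list, determined by its members. *)
Lemma increasing_eq (f g : 'I_k -> 'I_n) : increasing f -> increasing g ->
  (forall x, (x \in codom f) = (x \in codom g)) -> f =1 g.
Proof.
move=> hf hg e i.
have ss (h : 'I_k -> 'I_n) : increasing h -> sorted ltn (map val (codom h)).
  move=> hh; rewrite codomE -map_comp sorted_map.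
  have := iota_ltn_sorted 0 k; rewrite -val_enum_ord sorted_map.
  by apply: sub_sorted => a b /hh.
have E : map val (codom f) = map val (codom g).
  apply: (irr_sorted_eq ltn_trans ltnn) => //; rewrite ?ss //.
  by move=> x; apply/mapP/mapP => -[y yy ->]; exists y => //; rewrite ?e // -?e.
have := inj_map val_inj E; rewrite !codomE.
by move/eq_in_map/(_ i); apply; rewrite mem_enum.
Qed.

Lemma codom_elem I x : (x \in codom (elem I)) = (x \in val I).
Proof.
apply/codomP/idP => [[r ->]|xI]; first exact: enum_valP.
exists (cast_ord (eqP (valP I)) (enum_rank_in xI x)).
by rewrite /elem cast_ordK enum_rankK_in.
Qed.

Lemma elem_in I r : elem I r \in val I.
Proof. by rewrite -codom_elem codom_f. Qed.

Lemma in_elem I x : x \in val I -> exists r, elem I r = x.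
Proof. by rewrite -codom_elem => /codomP[r ->]; exists r. Qed.

Lemma elem_of_increasing (f : 'I_k -> 'I_n) (hf : increasing f) :
  elem (of_increasing hf) =1 f.
Proof.
apply: increasing_eq => //; first exact: elem_increasing.
by move=> x; rewrite codom_elem; apply/imsetP/codomP => -[r]; [move=> _|]; exists r.
Qed.

Lemma elem_inj I J : elem I =1 elem J -> I = J.
Proof.
move=> e; apply: val_inj; apply/setP => x; rewrite -!codom_elem.
by rewrite (eq_codom e).
Qed.

Lemma kleP I J : reflect (forall r, (elem I r <= elem J r)%N) (kle I J).
Proof. exact: forallP. Qed.

Lemma kle_refl I : kle I I.
Proof. by apply/kleP. Qed.

Lemma kle_trans J I K : kle I J -> kle J K -> kle I K.
Proof. by move=> /kleP a /kleP b; apply/kleP => r; apply: leq_trans (b r). Qed.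

Lemma kle_anti I J : kle I J -> kle J I -> I = J.
Proof.
move=> /kleP a /kleP b; apply: elem_inj => r; apply: val_inj => /=.
by have := a r; have := b r; lia.
Qed.

Lemma elem_ge I (r : 'I_k) : (r <= elem I r)%N.
Proof.
case: r => r rk; elim: r rk => // r IH rk.
have rk' : (r < k)%N by apply: ltnW.
have := @elem_increasing I (Ordinal rk') (Ordinal rk) (ltnSn r).
by have := IH rk' => /=; lia.
Qed.

End Coordinates.

Section Reversal.
Variables n k : nat.
Implicit Types I J : ksubset n k.

Lemma rev_increasing I : increasing (fun r => rev_ord (elem I (rev_ord r))).
Proof.
move=> i j ij /=; have := @elem_increasing n k I (rev_ord j) (rev_ord i).
have := ltn_ord (elem I (rev_ord i)); have := ltn_ord j => /=; lia.
Qed.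

Definition rev_ks I : ksubset n k := of_increasing (rev_increasing I).

Lemma elem_rev I r : elem (rev_ks I) r = rev_ord (elem I (rev_ord r)).
Proof. exact: elem_of_increasing. Qed.

Lemma rev_ksK : involutive rev_ks.
Proof. by move=> I; apply: elem_inj => r; rewrite !elem_rev !rev_ordK. Qed.

Lemma kle_rev I J : kle (rev_ks I) (rev_ks J) = kle J I.
Proof.
apply/kleP/kleP => h r; have := h (rev_ord r); rewrite !elem_rev ?rev_ordK /=.
  by have := ltn_ord (elem I r); have := ltn_ord (elem J r); lia.
by lia.
Qed.

End Reversal.

Section Corners.
Variables (n k : nat) (kn : (k <= n)%N).

Lemma left_increasing : increasing (widen_ord kn).
Proof. by []. Qed.

Lemma elem_Lset (r : 'I_k) : elem (Lset kn) r = r :> nat.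
Proof.
have -> : Lset kn = of_increasing left_increasing; last by rewrite elem_of_increasing.
apply: val_inj; apply/setP => i /=; rewrite inE; apply/idP/imsetP => [ik|[j _ ->]] //=.
by exists (Ordinal ik) => //; apply: val_inj.
Qed.

Lemma Lset_min I : kle (Lset kn) I.
Proof. by apply/kleP => r; rewrite elem_Lset elem_ge. Qed.

Lemma Rset_rev : Rset kn = rev_ks (Lset kn).
Proof.
apply: val_inj; apply/setP => i; rewrite inE /=.
apply/idP/imsetP => [ik|[r _ ->]] /=; last first.
  by rewrite elem_Lset /=; have := ltn_ord r; lia.
have h : (rev_ord i < k)%N by move=> /=; have := ltn_ord i; lia.
exists (rev_ord (Ordinal h)) => //; rewrite rev_ordK; apply: val_inj => /=.
by rewrite elem_Lset /=; have := ltn_ord i; lia.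
Qed.

Lemma Rset_max I : kle I (Rset kn).
Proof. by rewrite -[I]rev_ksK Rset_rev kle_rev Lset_min. Qed.

End Corners.

(** * A vanishing criterion for minors with adjacent columns *)

Section Determinants.
Variable R : comPzRingType.

Lemma minor_cofactor n k (A : 'M[R]_n) (f g : 'I_k -> 'I_n) s r :
  cofactor (mxsub f g A) s r =
  (-1) ^+ (s + r) * \det (mxsub (f \o lift s) (g \o lift r) A).
Proof. by rewrite /cofactor; congr (_ * \det _); apply/matrixP => i j; rewrite !mxE. Qed.

Lemma eq_cofactor n (G H : 'M[R]_n) s r :
  (forall i j, j != r -> G i j = H i j) -> cofactor G s r = cofactor H s r.
Proof.
move=> e; rewrite /cofactor; congr (_ * \det _); apply/matrixP => i j.
by rewrite !mxE e // eq_sym neq_lift.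
Qed.

(** A three-term Pluecker relation. Let [G], [H], [K] consist of the same columns
    except in the positions [r'] and [r], where they have [xy], [xz], [yz]
    respectively. For [r = r' + 1] and [\det H = 0] the relation reads
    [det (xy) * minor (z) = - det (yz) * minor (x)], where the minors omit the
    row [s] and the sign is hidden in the cofactors. It holds because [adj H * G]
    has only one nonzero column: compute [adj H * G * adj G] in two ways. *)
Lemma three_term n (G H K : 'M[R]_n) (r r' : 'I_n) s :
    (forall i j, j != r -> G i j = H i j) ->
    (forall i j, K i j = if j == r' then G i r else H i j) ->
    \det H = 0 ->
  \det G * cofactor H s r' = \det K * cofactor G s r.
Proof.
move=> eGH eK H0.
have : (\adj H *m (G *m \adj G)) r' s = ((\adj H *m G) *m \adj G) r' s by rewrite mulmxA.
rewrite mul_mx_adj mul_mx_scalar 2!mxE => ->.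
rewrite [LHS]mxE (bigD1 r) //= big1 ?addr0 => [|j jr].
  rewrite [\adj G r s]mxE; congr (_ * _).
  rewrite (expand_det_col K r') mxE; apply: eq_bigr => i _.
  rewrite mxE eK eqxx mulrC; congr (_ * _).
  by apply: eq_cofactor => i' j /negbTE jr; rewrite eK jr.
have -> : (\adj H *m G) r' j = (\adj H *m H) r' j.
  by rewrite !mxE; apply: eq_bigr => i _; rewrite eGH.
by rewrite mul_adj_mx H0 mxE mul0rn mul0r.
Qed.

End Determinants.

Definition replace k n (g : 'I_k -> 'I_n) (r : 'I_k) (c : 'I_n) : 'I_k -> 'I_n :=
  fun j => if j == r then c else g j.

Section Pivot.
Variables (R : realType) (n : nat).
Implicit Type A : 'M[R]_n.

Lemma minor_of_increasing k (f g : 'I_k -> 'I_n) (hf : increasing f) (hg : increasing g) A :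
  minor (of_increasing hf) (of_increasing hg) A = \det (mxsub f g A).
Proof.
by rewrite /minor; congr (\det _); apply: eq_mxsub; apply: elem_of_increasing.
Qed.

Lemma tn_minor A k (f g : 'I_k -> 'I_n) : totally_nonnegative A ->
  increasing f -> increasing g -> 0 <= \det (mxsub f g A).
Proof. by move=> tA hf hg; rewrite -(minor_of_increasing hf hg). Qed.

Definition prepend k (a : 'I_n) (f : 'I_k -> 'I_n) : 'I_k.+1 -> 'I_n :=
  fun i => oapp f a (unlift ord0 i).

Lemma prepend0 k (a : 'I_n) (f : 'I_k -> 'I_n) : prepend a f ord0 = a.
Proof. by rewrite /prepend unlift_none. Qed.

Lemma prepend_lift k (a : 'I_n) (f : 'I_k -> 'I_n) j : prepend a f (lift ord0 j) = f j.
Proof. by rewrite /prepend liftK. Qed.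

Lemma prepend_increasing k (a : 'I_n) (f : 'I_k.+1 -> 'I_n) :
  increasing f -> (a < f ord0)%N -> increasing (prepend a f).
Proof.
move=> hf af i j; rewrite /prepend.
case: (unliftP ord0 i) => [i'|] ->; case: (unliftP ord0 j) => [j'|] -> //=.
  by rewrite /bump /= ltnS; apply: hf.
move=> _; apply: leq_trans af _.
by case: (posnP j') => [j0|j0]; [rewrite (_ : j' = ord0) //; apply: val_inj | apply/ltnW/hf].
Qed.

Variables (A : 'M[R]_n) (i0 b c : 'I_n).
Hypotheses (tA : totally_nonnegative A) (bc : c = b.+1 :> nat) (piv : 0 < A i0 c).
Hypothesis (right0 : forall q : 'I_n, (c < q)%N -> A i0 q = 0).
Hypothesis (above0 : forall i q : 'I_n, (i < i0)%N -> (b <= q)%N -> A i q = 0).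

(** Suppose the minor with [c] in place of [b] vanishes. If some column precedes
    [b], let [r'] be the position just before it: the minor without column [r']
    and without a suitable row [s] is nonzero, and by induction so is the same
    minor with [c] in place of [b]. The three-term relation then equates a
    positive number with a nonpositive one. If [b] comes first, all columns used
    are at least [b], where row [i0] is supported on [b] and [c] only; expanding
    along that row, or along that row prepended to the minor, settles the case. *)
Lemma pivot_column k (f g : 'I_k -> 'I_n) (r : 'I_k) :
    increasing f -> increasing g -> increasing (replace g r c) -> g r = b ->
    \det (mxsub f g A) != 0 ->
  \det (mxsub f (replace g r c) A) != 0.
Proof.
elim: k f g r => [|k IH] f g r hf hg hgr gr dG; first by case: r {hgr gr}.
apply/eqP => H0.
have dG0 : 0 < \det (mxsub f g A) by rewrite lt_neqAle eq_sym dG tn_minor.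
have [r0|rpos] := posnP r.
  have gb j : (b <= g j)%N.
    have [/val_inj<-|] := eqVneq (r : nat) j; first by rewrite gr.
    by rewrite -gr => ne; apply/ltnW/hg; lia.
  have gc j : j != r -> (c < g j)%N.
    move=> jr; have := hgr r j; rewrite /replace eqxx (negbTE jr); apply.
    by move: jr; rewrite -val_eqE /=; lia.
  have [fi|fi|fi] := ltngtP (f r) i0.
  - case/eqP: dG; rewrite (expand_det_row _ r) big1 // => j _.
    by rewrite mxE above0 ?mul0r.
  - (* row [i0] and column [b] can be put in front: the larger minor equals
       [- A i0 c * \det (mxsub f g A)] since the other term of the expansion
       is the vanishing minor *)
    have er : r = ord0 by apply: val_inj.
    have := tn_minor tA (prepend_increasing hf (_ : i0 < f ord0)%N)
       (prepend_increasing hgr (_ : b < replace g r c ord0)%N).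
    rewrite /replace -er eqxx bc => /(_ fi (ltnSn _)).
    rewrite -/(replace g r c).
    rewrite (expand_det_row _ ord0) !big_ord_recl big1 => [|j _]; last first.
      rewrite mxE prepend0 prepend_lift right0 ?mul0r //.
      by rewrite /replace ifN ?gc // -val_eqE /= r0.
    rewrite !minor_cofactor !mxE !prepend0 prepend_lift {2}/replace -er eqxx.
    rewrite (_ : \det _ = \det (mxsub f (replace g r c) A)); last first.
      by congr (\det _); apply: eq_mxsub => j /=; rewrite prepend_lift.
    rewrite H0 !mulr0 add0r addr0 (_ : \det _ = \det (mxsub f g A)); last first.
      congr (\det _); apply: eq_mxsub => j /=; first by rewrite prepend_lift.
      have [->|jr] := eqVneq j r.
        rewrite (_ : lift _ _ = ord0) ?prepend0 ?gr //.
        by apply: val_inj; rewrite /= r0.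
      rewrite (_ : lift _ _ = lift ord0 j) ?prepend_lift /replace ?(negbTE jr) //.
      by apply: val_inj; move: jr; rewrite -val_eqE /= r0 /bump /=; lia.
    by rewrite /= r0 /= expr1 mulN1r mulrN oppr_ge0 leNgt mulr_gt0.
  - (* both minors are multiples of the same cofactor *)
    have e (h : 'I_k.+1 -> 'I_n) : (forall j, j != r -> (c < h j)%N) ->
        \det (mxsub f h A) = A i0 (h r) * cofactor (mxsub f h A) r r.
      move=> hh; rewrite (expand_det_row _ r) (bigD1 r) //= big1 ?addr0 => [|j jr].
        by rewrite mxE (val_inj fi).
      by rewrite mxE (val_inj fi) right0 ?mul0r ?hh.
    have ge j : j != r -> (c < replace g r c j)%N.
      by move=> jr; rewrite /replace (negbTE jr) gc.
    case/eqP: dG; move: H0; rewrite (e _ gc) (e _ ge) {1}/replace eqxx.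
    move/eqP; rewrite mulf_eq0 gt_eqF //= => /eqP H0.
    suff -> : cofactor (mxsub f g A) r r = cofactor (mxsub f (replace g r c) A) r r.
      by rewrite H0 mulr0.
    by apply: eq_cofactor => i j jr; rewrite !mxE /replace (negbTE jr).
have rk : (r.-1 < k.+1)%N by have := ltn_ord r; lia.
set r' : 'I_k.+1 := Ordinal rk.
have r'r : r' != r by rewrite -val_eqE /=; lia.
have [r1 er1] : exists r1, r = lift r' r1.
  by case: (unliftP r' r) => [r1 e|e]; [exists r1|rewrite e eqxx in r'r].
have [s ds] : exists s, \det (mxsub (f \o lift s) (g \o lift r') A) != 0.
  apply/existsP; apply: contraT => /existsPn none.
  case/eqP: dG; rewrite (expand_det_col _ r') big1 // => s _.
  by have := none s; rewrite negbK minor_cofactor => /eqP->; rewrite !mulr0.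
have eg : replace (g \o lift r') r1 c =1 replace g r c \o lift r'.
  by move=> j; rewrite /replace /= er1 (inj_eq lift_inj).
have incg : increasing (replace g r c \o lift r').
  by apply: increasing_comp hgr (@increasing_lift _ _).
have d1 : \det (mxsub (f \o lift s) (replace g r c \o lift r') A) != 0.
  rewrite -(eq_mxsub _ _ (frefl _) eg A); apply: IH => //.
  - exact: increasing_comp hf (@increasing_lift _ _).
  - exact: increasing_comp hg (@increasing_lift _ _).
  - by move=> i j; rewrite !eg; apply: incg.
  - by rewrite /= -er1.
have er' : r = r'.+1 :> nat by rewrite /= prednK.
have inc2 : increasing (replace (replace g r c) r' b).
  move=> i j ij; rewrite {1 3}/replace; have := hgr i j ij.
  case: eqVneq => [ei|ni]; case: eqVneq => [ej|nj] //.
  - by move: ij; rewrite ei ej ltnn.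
  - move=> _; rewrite /replace; case: eqVneq => [_|nj']; first by rewrite bc.
    by rewrite -gr; apply: hg; move: ij nj'; rewrite ei -val_eqE er' /=; lia.
  - move=> _; rewrite /replace ifN; last by rewrite -val_eqE /=; move: ij; rewrite ej /=; lia.
    by rewrite -gr; apply: hg; move: ij; rewrite ej /=; lia.
have e1 i j : j != r -> mxsub f g A i j = mxsub f (replace g r c) A i j.
  by move=> jr; rewrite !mxE /replace (negbTE jr).
have e2 i j : mxsub f (replace (replace g r c) r' b) A i j =
    if j == r' then mxsub f g A i r else mxsub f (replace g r c) A i j.
  by rewrite !mxE {1}/replace; case: eqP => // _; rewrite gr.
have := three_term s e1 e2 H0.
rewrite !minor_cofactor er' addnS exprS mulN1r !mulNr mulrN.
rewrite !(mulrCA _ (_ ^+ _)) -mulrN => /(mulfI _); rewrite signr_eq0 => /(_ isT).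
have d1_gt0 : 0 < \det (mxsub (f \o lift s) (replace g r c \o lift r') A).
  rewrite lt_neqAle eq_sym d1 tn_minor //.
  exact: increasing_comp hf (@increasing_lift _ _).
have d2_ge0 : 0 <= \det (mxsub (f \o lift s) (g \o lift r) A).
  by apply: tn_minor => //; apply: increasing_comp => //; apply: increasing_lift.
have q_ge0 := tn_minor tA hf inc2.
move=> E; have := mulr_gt0 dG0 d1_gt0; rewrite E oppr_gt0 ltNge.
by rewrite mulr_ge0.
Qed.

End Pivot.

(** * Moving one element of a k-subset *)

Section Moves.
Variables (n k : nat) (b c : 'I_n).
Hypothesis bc : c = b.+1 :> nat.
Implicit Types I J K : ksubset n k.

Lemma up_increasing J :
  increasing (fun r => if (elem J r == b) && (c \notin val J) then c else elem J r).
Proof.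
move=> i j ij; have e := elem_increasing J ij.
case: ifP => [/andP[/eqP ei cJ]|_]; case: ifP => [/andP[/eqP ej _]|_] //.
- by move: e; rewrite ei ej ltnn.
- rewrite ltn_neqAle; apply/andP; split; last by rewrite bc -ei.
  by apply: contra cJ => /eqP/val_inj ->; apply: elem_in.
- by rewrite bc ltnS -ej ltnW.
Qed.

Lemma down_increasing J :
  increasing (fun r => if (elem J r == c) && (b \notin val J) then b else elem J r).
Proof.
move=> i j ij; have e := elem_increasing J ij.
case: ifP => [/andP[/eqP ei _]|_]; case: ifP => [/andP[/eqP ej bJ]|_] //.
- by move: e; rewrite ei ej ltnn.
- by move: e; rewrite ei bc => /ltnW.
- rewrite ltn_neqAle; apply/andP; split; last by rewrite -ltnS -bc -ej.
  by apply: contra bJ => /eqP/val_inj <-; apply: elem_in.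
Qed.

Definition up J : ksubset n k := of_increasing (up_increasing J).
Definition down J : ksubset n k := of_increasing (down_increasing J).

Lemma elem_up J r :
  elem (up J) r = if (elem J r == b) && (c \notin val J) then c else elem J r.
Proof. exact: elem_of_increasing. Qed.

Lemma elem_down J r :
  elem (down J) r = if (elem J r == c) && (b \notin val J) then b else elem J r.
Proof. exact: elem_of_increasing. Qed.

Lemma kle_up J : kle J (up J).
Proof. by apply/kleP => r; rewrite elem_up; case: ifP => // /andP[/eqP-> _]; rewrite bc. Qed.

Lemma kle_down J : kle (down J) J.
Proof. by apply/kleP => r; rewrite elem_down; case: ifP => // /andP[/eqP-> _]; rewrite bc. Qed.

(** If [b] moves up in [I] but is blocked in [J] by a later [c], then [I], which
    lies below [J], has room for nothing but [c] at that place. *)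
Lemma up_homo : {homo up : I J / kle I J}.
Proof.
move=> I J /kleP IJ; apply/kleP => r; rewrite !elem_up.
have rIJ := IJ r.
case: ifP => [/andP[/eqP er cI]|nI]; case: ifP => [/andP[/eqP er' cJ]|nJ] //.
- move: rIJ; rewrite er leq_eqVlt => /orP[/eqP/val_inj eb|]; last by rewrite bc.
  move: nJ; rewrite -eb eqxx => /negbFE/in_elem[s es].
  have rs : (r < s)%N by rewrite -(increasing_lt r s (elem_increasing J)) es -eb bc.
  case/negP: cI; rewrite (_ : c = elem I s) ?elem_in //; apply: val_inj => /=.
  by have := IJ s; have := elem_increasing I rs; rewrite es er bc; lia.
- by move: rIJ; rewrite er' bc => /leqW.
Qed.

Lemma down_homo : {homo down : I J / kle I J}.
Proof.
move=> I J /kleP IJ; apply/kleP => r; rewrite !elem_down.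
have rIJ := IJ r.
case: ifP => [/andP[/eqP er bI]|nI]; case: ifP => [/andP[/eqP er' bJ]|nJ] //.
- by move: rIJ; rewrite er bc => /ltnW.
- move: rIJ; rewrite er' leq_eqVlt => /orP[/eqP/val_inj ec|]; last by rewrite bc ltnS.
  move: nI; rewrite ec eqxx => /negbFE/in_elem[s es].
  have sr : (s < r)%N by rewrite -(increasing_lt s r (elem_increasing I)) es ec bc.
  case/negP: bJ; rewrite (_ : b = elem J s) ?elem_in //; apply: val_inj => /=.
  by have := IJ s; have := elem_increasing J sr; rewrite es er' bc; lia.
Qed.

Lemma kle_up_down J : kle J (up (down J)).
Proof.
apply/kleP => r; rewrite elem_up.
have [/andP[/eqP ej bJ]|] := boolP ((elem J r == c) && (b \notin val J)).
  rewrite elem_down ej bJ !eqxx /=; case: ifP => // /negbFE/(@in_elem _ _ (down J))[s].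
  rewrite elem_down; case: ifP => [_ /(congr1 val)/=|h es]; first by lia.
  by move: h; rewrite es eqxx bJ.
move=> h; rewrite elem_down (negbTE h); case: ifP => // /andP[/eqP -> _].
by rewrite bc.
Qed.

Lemma kle_down_up J : kle (down (up J)) J.
Proof.
apply/kleP => r; rewrite elem_down.
have [/andP[/eqP ej cJ]|] := boolP ((elem J r == b) && (c \notin val J)).
  rewrite elem_up ej cJ !eqxx /=; case: ifP => // /negbFE/(@in_elem _ _ (up J))[s].
  rewrite elem_up; case: ifP => [_ /(congr1 val)/=|h es]; first by lia.
  by move: h; rewrite es eqxx cJ.
move=> h; rewrite elem_up (negbTE h); case: ifP => // /andP[/eqP -> _].
by rewrite bc.
Qed.

(** The lifting property of the order, for intervals. If [J] lies below [up M] but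
    not below [M], then at the only place where they differ [J] has [c] and [M]
    has [b]; so [L], being below [M], does not obstruct moving [J] down. *)
Lemma up_interval L M J : kle L M ->
  kle L J && kle J (up M) = (kle L J && kle J M) || (kle L (down J) && kle (down J) M).
Proof.
move=> LM; apply/andP/orP => [[LJ JM]|[]/andP[LJ JM]].
- have [JM'|nJM] := boolP (kle J M); [left; by rewrite LJ|right].
  have dJM := kle_trans (down_homo JM) (kle_down_up M).
  rewrite dJM andbT.
  move: nJM; rewrite negb_forall => /existsP[r]; rewrite -ltnNge => mr.
  have := kleP _ _ JM r; rewrite elem_up; case: ifP => [/andP[/eqP em _] jr|_]; last by lia.
  apply/kleP => s; rewrite elem_down; case: ifP => [/andP[/eqP es _]|_]; last exact: (kleP _ _ LJ).
  have sr : s = r.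
    apply: (increasing_inj (elem_increasing J)); rewrite es; apply: val_inj => /=.
    by move: mr; rewrite em bc in jr *; lia.
  by rewrite sr -em (kleP _ _ LM).
- by split=> //; apply: kle_trans JM (kle_up M).
- split; first exact: kle_trans LJ (kle_down J).
  exact: kle_trans (kle_up_down J) (up_homo JM).
Qed.

End Moves.

(** * Shears and the intervals of positive minors *)

Section Shear.
Variables (R : realType) (n : nat) (b c : 'I_n).
Hypothesis bc : c = b.+1 :> nat.
Implicit Types X : 'M[R]_n.

Definition shear (t : R) : 'M[R]_n := 1%:M + t *: delta_mx b c.

Lemma mxsubE p q (f : 'I_p -> 'I_n) (g : 'I_q -> 'I_n) X i j :
  mxsub f g X i j = X (f i) (g j).
Proof. by rewrite mxE. Qed.

Lemma mul_shearE X t i j :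
  (X *m shear t) i j = X i j + (if j == c then t * X i b else 0).
Proof.
rewrite /shear mulmxDr mulmx1 -scalemxAr !mxE; congr (_ + _).
rewrite (bigD1 b) //= big1 ?addr0 => [|l lb]; rewrite !mxE.
  by rewrite eqxx; case: eqP => _; rewrite ?mulr1 ?mulr0.
by rewrite (negbTE lb) mulr0.
Qed.

Lemma det_mul_shear k (f g : 'I_k -> 'I_n) r X t : increasing g -> g r = c ->
  \det (mxsub f g (X *m shear t)) =
    \det (mxsub f g X) + t * \det (mxsub f (replace g r b) X).
Proof.
move=> hg gr; rewrite !(expand_det_col _ r) mulr_sumr -big_split /=.
have e j : j != r -> g j != c.
  by apply: contra => /eqP; rewrite -gr => /(increasing_inj hg) ->.
apply: eq_bigr => i _; rewrite !mxsubE mul_shearE gr eqxx /replace eqxx mulrDl [t * (_ * _)]mulrA.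
congr (_ * _ + _ * _); apply: eq_cofactor => i' j jr; rewrite !mxsubE.
  by rewrite mul_shearE (negbTE (e _ jr)) addr0.
by rewrite (negbTE jr) mul_shearE (negbTE (e _ jr)) addr0.
Qed.

(** When [b] already belongs to [J], the extra term has two equal columns. *)
Lemma minor_mul_shear k (I J : ksubset n k) X t :
  minor I J (X *m shear t) = minor I J X +
   (if (c \in val J) && (b \notin val J) then t * minor I (down bc J) X else 0).
Proof.
case: ifP => [/andP[/in_elem[r er] bJ]|nJ].
  rewrite /minor (det_mul_shear _ _ _ (elem_increasing J) er); congr (_ + _ * \det _).
  apply: eq_mxsub => // j; rewrite elem_down bJ andbT /replace -er.
  by rewrite (inj_eq (increasing_inj (elem_increasing J))).
have [/in_elem[r er]|cJ] := boolP (c \in val J).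
  have /in_elem[s es] : b \in val J by move: nJ; rewrite -er elem_in => /negbFE.
  rewrite /minor (det_mul_shear _ _ _ (elem_increasing J) er).
  rewrite [X in _ + _ * X](_ : _ = 0) ?mulr0 //.
  rewrite -det_tr; have rs : r != s.
    by apply/eqP => e; move: er; rewrite e es => /(congr1 val) /=; lia.
  apply: (determinant_alternate rs) => j; rewrite !mxE /replace eqxx.
  by rewrite eq_sym (negbTE rs) es.
rewrite addr0 /minor; congr (\det _); apply/matrixP => i j.
rewrite !mxsubE mul_shearE ifN ?addr0 //.
by apply: contra cJ => /eqP<-; apply: elem_in.
Qed.

End Shear.

Section Tracking.
Variables (R : realType) (n k : nat).
Implicit Types (X A B : 'M[R]_n) (I J : ksubset n k).

Definition interval_support X (L M : ksubset n k -> ksubset n k) : Prop :=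
  (forall I, kle (L I) I && kle I (M I)) /\
  forall I J, 0 <= minor I J X /\ (0 < minor I J X) = kle (L I) J && kle J (M I).

(** The composition rule is part of the definition: composing two relations given
    by intervals does not give intervals in general, even for monotone end
    points, whereas this property is stable under products. *)
Definition transports A (lam rho : ksubset n k -> ksubset n k) : Prop :=
  [/\ forall I, kle (lam I) I && kle I (rho I),
      {homo lam : I J / kle I J}, {homo rho : I J / kle I J} &
      forall X L M, interval_support X L M ->
        interval_support (X *m A) (lam \o L) (rho \o M)].

Lemma transports_mul A B l r l' r' :
  transports A l r -> transports B l' r' -> transports (A *m B) (l' \o l) (r' \o r).
Proof.
move=> [a1 a2 a3 a4] [b1 b2 b3 b4]; split.
- move=> I /=; have /andP[h1 h2] := a1 I.
  have /andP[h3 _] := b1 (l I); have /andP[_ h4] := b1 (r I).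
  by rewrite (kle_trans h3 h1) (kle_trans h2 h4).
- by move=> I J /a2 /b2.
- by move=> I J /a3 /b3.
- by move=> X L M /a4 /b4; rewrite mulmxA.
Qed.

Lemma transports_shear (b c : 'I_n) (bc : c = b.+1 :> nat) (t : R) :
  0 < t -> transports (shear b c t) id (up bc).
Proof.
move=> t0; split=> //.
- by move=> I; rewrite kle_refl kle_up.
- exact: up_homo.
move=> X L M [h1 h2]; split=> [I|I J] /=.
  by have /andP[-> h] := h1 I; apply: kle_trans h (kle_up _ _).
have [p1 s1] := h2 I J; have [p2 s2] := h2 I (down bc J).
have LM : kle (L I) (M I) by have /andP[a d] := h1 I; apply: kle_trans a d.
rewrite up_interval // -s1 -s2 (minor_mul_shear bc).
case: ifP => [_|nJ]; last first.
  rewrite (_ : down bc J = J) ?orbb ?addr0 //.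
  apply: elem_inj => r; rewrite elem_down; case: ifP => // /andP[/eqP er bJ].
  by move: nJ; rewrite -er elem_in bJ.
split; first by rewrite addr_ge0 // mulr_ge0 // ltW.
have [m1|] := boolP (0 < minor I J X); first by rewrite ltr_wpDr ?mulr_ge0 // ltW.
rewrite -leNgt => m1; have -> : minor I J X = 0 by apply: le_anti; rewrite m1 p1.
by rewrite add0r pmulr_rgt0.
Qed.

Lemma transports_diag (d : 'rV[R]_n) :
  (forall i, 0 < d 0 i) -> transports (diag_mx d) id id.
Proof.
move=> d0; split=> // [I|X L M [h1 h2]]; first by rewrite !kle_refl.
split=> // I J; rewrite /minor.
rewrite (_ : mxsub _ _ _ = mxsub (elem I) (elem J) X *m diag_mx (\row_j d 0 (elem J j))).
  rewrite det_mulmx det_diag.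
  have p0 : 0 < \prod_i (\row_j d 0 (elem J j)) 0 i by apply: prodr_gt0 => i _; rewrite mxE.
  by have [a e] := h2 I J; rewrite (pmulr_lgt0 _ p0) pmulr_lge0.
by apply/matrixP => i j; rewrite mxE !mul_mx_diag !mxE.
Qed.

End Tracking.

(** * Reversal of rows and columns *)

Section ReverseMatrix.
Variables (R : realType) (n : nat).
Implicit Types (X A B : 'M[R]_n).

Definition rev_mx A : 'M[R]_n := mxsub (@rev_ord n) (@rev_ord n) A.

Lemma rev_mxK : involutive rev_mx.
Proof. by move=> A; apply/matrixP => i j; rewrite !mxE !rev_ordK. Qed.

Lemma rev_mx_mul A B : rev_mx (A *m B) = rev_mx A *m rev_mx B.
Proof.
apply/matrixP => i j; rewrite !mxE (reindex_inj rev_ord_inj).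
by apply: eq_bigr => l _; rewrite !mxE.
Qed.

Lemma det_rev_mx k (A : 'M[R]_k) : \det (mxsub (@rev_ord k) (@rev_ord k) A) = \det A.
Proof.
pose s := perm (@rev_ord_inj k).
have -> : mxsub (@rev_ord k) (@rev_ord k) A = row_perm s (col_perm s A).
  by apply/matrixP => i j; rewrite !mxE !permE.
rewrite row_permE col_permE !det_mulmx !det_perm odd_permV mulrCA mulrA.
by rewrite -mulrA -signr_addb addbb mulr1.
Qed.

Lemma minor_rev k (I J : ksubset n k) A : minor (rev_ks I) (rev_ks J) (rev_mx A) = minor I J A.
Proof.
rewrite /minor -[RHS]det_rev_mx; congr (\det _).
by apply/matrixP => i j; rewrite !mxE !elem_rev !rev_ordK.
Qed.

Lemma interval_support_rev k X (L M : ksubset n k -> _) : interval_support X L M ->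
  interval_support (rev_mx X) (@rev_ks n k \o M \o @rev_ks n k) (@rev_ks n k \o L \o @rev_ks n k).
Proof.
move=> [h1 h2]; split=> [I|I J] /=.
  have /andP[a e] := h1 (rev_ks I).
  by rewrite -{2}[I]rev_ksK kle_rev e -{1}[I]rev_ksK kle_rev a.
rewrite -{1 2}[I]rev_ksK -{1 2 3 4}[J]rev_ksK minor_rev !kle_rev.
by have [a ->] := h2 (rev_ks I) (rev_ks J); rewrite andbC.
Qed.

Lemma transports_rev k A (l r : ksubset n k -> _) : transports A l r ->
  transports (rev_mx A) (@rev_ks n k \o r \o @rev_ks n k) (@rev_ks n k \o l \o @rev_ks n k).
Proof.
move=> [h1 h2 h3 h4]; split.
- move=> I /=; have /andP[a e] := h1 (rev_ks I).
  by rewrite -{2}[I]rev_ksK kle_rev e -{1}[I]rev_ksK kle_rev a.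
- by move=> I J IJ /=; rewrite kle_rev h3 ?kle_rev.
- by move=> I J IJ /=; rewrite kle_rev h2 ?kle_rev.
move=> X L M hX.
have [] := interval_support_rev (h4 _ _ _ (interval_support_rev hX)).
rewrite rev_mx_mul rev_mxK => a e; split=> [I|I J] /=.
  by have := a I; rewrite /= !rev_ksK.
by have := e I J; rewrite /= !rev_ksK.
Qed.

End ReverseMatrix.

(** * Factoring totally nonnegative matrices *)

Section Factorization.
Variables (R : realType) (n : nat).
Implicit Types A : 'M[R]_n.

(** Minors of all sizes are indexed by one finite type, so that they can be counted
    and a ratio of minors can be minimized over all of them at once. *)
Definition minor_index : finType :=
  {k : 'I_n.+1 & (ksubset n k * ksubset n k)%type}.

Definition minor_support A : {set minor_index} :=
  [set u | 0 < minor (tagged u).1 (tagged u).2 A].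

Lemma ksubset_le k (I : ksubset n k) : (k < n.+1)%N.
Proof. by rewrite ltnS -(eqP (valP I)) -[leqRHS]card_ord max_card. Qed.

Definition index_of k (I J : ksubset n k) : minor_index :=
  Tagged (fun k : 'I_n.+1 => (ksubset n k * ksubset n k)%type)
    ((I, J) : ksubset n (Ordinal (ksubset_le I)) * ksubset n (Ordinal (ksubset_le I))).

Lemma tn_entry A i j : totally_nonnegative A -> 0 <= A i j.
Proof.
move=> tA; have := tn_minor tA (const_increasing i) (const_increasing j).
by rewrite det_mx11 mxE.
Qed.

Lemma mul_shearNK (b c : 'I_n) (bc : c = b.+1 :> nat) t A :
  A *m shear b c (- t) *m shear b c t = A.
Proof.
apply/matrixP => i j; rewrite !mul_shearE.
have -> : (b == c) = false by apply/eqP => /(congr1 val) /=; lia.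
by case: (j == c); rewrite ?addr0 // mulNr subrK.
Qed.

(** The factor [t] is the least ratio of the [(I, J)]-minor to the [(I, down J)]-minor,
    so dividing by the shear keeps minors nonnegative and kills one where the
    ratio is attained; nonsingularity makes column [b] nonzero, so that ratios
    exist (already among entries). *)
Lemma shear_reduction (b c : 'I_n) (bc : c = b.+1 :> nat) A :
    totally_nonnegative A -> \det A != 0 ->
    (forall k (I J : ksubset n k), c \in val J -> b \notin val J ->
       minor I (down bc J) A != 0 -> minor I J A != 0) ->
  exists2 t, 0 < t & exists A', [/\ totally_nonnegative A',
    minor_support A' \proper minor_support A & A = A' *m shear b c t].
Proof.
move=> tA dA hA.
have bNc : b != c by rewrite -val_eqE /=; lia.
pose good (u : minor_index) := [&& c \in val (tagged u).2, b \notin val (tagged u).2 &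
  minor (tagged u).1 (down bc (tagged u).2) A != 0].
pose ratio (u : minor_index) :=
  minor (tagged u).1 (tagged u).2 A / minor (tagged u).1 (down bc (tagged u).2) A.
have [u0 good0] : exists u, good u.
  have [i Ai] : exists i, A i b != 0.
    apply/existsP; apply: contraNT dA => /existsPn Ab.
    rewrite (expand_det_col _ b) big1 // => i _.
    by have := Ab i; rewrite negbK => /eqP->; rewrite mul0r.
  pose J := of_increasing (const_increasing c).
  have cJ : c \in val J by apply/imsetP; exists ord0.
  have bJ : b \notin val J by apply/imsetP => -[_ _ e]; rewrite e eqxx in bNc.
  exists (index_of (of_increasing (const_increasing i)) J).
  apply/and3P; split=> //; rewrite /minor /= det_mx11 mxE elem_down elem_of_increasing.
  by rewrite elem_of_increasing eqxx bJ.
case: (@arg_minP _ _ _ u0 good ratio good0) => u /and3P[cu bu mu] umin.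
have u_gt0 : 0 < ratio u.
  by rewrite divr_gt0 // lt_neqAle eq_sym tA andbT // hA.
pose A' := A *m shear b c (- ratio u).
have minorA' k (I J : ksubset n k) : minor I J A' = minor I J A -
    (if (c \in val J) && (b \notin val J) then ratio u * minor I (down bc J) A else 0).
  by rewrite (minor_mul_shear bc); case: ifP => _; rewrite ?mulNr ?subr0 ?addr0.
have leA' k (I J : ksubset n k) : minor I J A' <= minor I J A.
  by rewrite minorA' gerBl; case: ifP => // _; rewrite mulr_ge0 // ltW.
exists (ratio u) => //; exists A'; split; last by rewrite mul_shearNK.
- move=> k I J; rewrite minorA' subr_ge0; case: ifP => // /andP[cJ bJ].
  have [->|mJ] := eqVneq (minor I (down bc J) A) 0; first by rewrite mulr0.
  rewrite -ler_pdivlMr; last by rewrite lt_neqAle eq_sym mJ tA.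
  have goodJ : good (index_of I J) by apply/and3P.
  exact: umin _ goodJ.
- rewrite properE; apply/andP; split.
    by apply/subsetP => v; rewrite !inE => h; apply: lt_le_trans h (leA' _ _ _).
  apply/negP => /subsetP/(_ u); rewrite !inE minorA' cu bu /= /ratio divfK // subrr ltxx.
  by rewrite lt_neqAle eq_sym hA // tA => /(_ isT).
Qed.

Lemma upper_reduction A (i1 j1 : 'I_n) :
    totally_nonnegative A -> \det A != 0 -> (i1 < j1)%N -> A i1 j1 != 0 ->
  exists (b c : 'I_n) (bc : c = b.+1 :> nat), exists2 t, 0 < t &
    exists A', [/\ totally_nonnegative A',
      minor_support A' \proper minor_support A & A = A' *m shear b c t].
Proof.
move=> tA dA ij1 Aij1.
pose upper (i : 'I_n) := [exists j : 'I_n, (i < j)%N && (A i j != 0)].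
have h1 : upper i1 by apply/existsP; exists j1; rewrite ij1.
case: (@arg_minnP _ i1 upper (@nat_of_ord n) h1) => i0 /existsP[j0 /andP[ij0 Aij0]] imin.
pose nz (j : 'I_n) := A i0 j != 0.
case: (@arg_maxnP _ j0 nz (@nat_of_ord n) Aij0) => c Ac cmax.
have cj0 := cmax _ Aij0.
have bP : (c.-1 < n)%N by have := ltn_ord c; lia.
pose b : 'I_n := Ordinal bP.
have bc : c = b.+1 :> nat by rewrite /= prednK //; move: cj0 => /=; lia.
have i0b : (i0 <= b)%N by move: cj0 => /=; lia.
exists b, c, bc; apply: shear_reduction => // k I J cJ bJ.
have /in_elem[r er] := cJ.
have eJ : elem J =1 replace (elem (down bc J)) r c.
  move=> s; rewrite /replace elem_down bJ andbT; case: eqVneq => [->//|sr].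
  by rewrite -er (inj_eq (increasing_inj (elem_increasing J))) (negbTE sr).
rewrite /minor (eq_mxsub _ _ (frefl _) eJ A) => m0; apply: (pivot_column tA bc (i0 := i0)) => //.
- by rewrite lt_neqAle eq_sym tn_entry // andbT.
- move=> q cq; apply/eqP; apply: contraTT cq => /cmax /=; rewrite -leqNgt; exact.
- move=> i q ii0 bq; apply/eqP; apply: contraTT ii0 => Aiq; rewrite -leqNgt.
  have [iq|qi] := ltnP i q; first by apply: imin; apply/existsP; exists q; rewrite iq.
  exact: leq_trans i0b (leq_trans bq qi).
- exact: elem_increasing.
- exact: elem_increasing.
- by move=> i j ij; rewrite -!eJ; apply: elem_increasing.
- by rewrite elem_down er eqxx bJ.
Qed.

Lemma rev_tn A : totally_nonnegative A -> totally_nonnegative (rev_mx A).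
Proof. by move=> tA k I J; rewrite -[I]rev_ksK -[J]rev_ksK minor_rev. Qed.

Lemma card_minor_support_rev A : #|minor_support (rev_mx A)| = #|minor_support A|.
Proof.
pose f (u : minor_index) : minor_index :=
  Tagged (fun k : 'I_n.+1 => (ksubset n k * ksubset n k)%type)
    (rev_ks (tagged u).1, rev_ks (tagged u).2).
have fK : involutive f by case=> k [I J]; rewrite /f /= !rev_ksK.
have key u : (f u \in minor_support (rev_mx A)) = (u \in minor_support A).
  by rewrite !inE /= minor_rev.
rewrite -[RHS](card_imset _ (inv_inj fK)); apply: eq_card => u.
by rewrite -[u]fK key (mem_imset _ _ (inv_inj fK)).
Qed.

(** An entry above the diagonal lets a shear be divided out; an entry below the
    diagonal does so after reversal, which preserves the number of positive minors. *)
Lemma transports_tn k A : totally_nonnegative A -> \det A != 0 ->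
  exists l r : ksubset n k -> ksubset n k, transports A l r.
Proof.
have [N] := ubnP #|minor_support A|; elim: N A => // N IH A AN tA dA.
have step B : (#|minor_support B| <= N)%N -> totally_nonnegative B -> \det B != 0 ->
    (exists i j : 'I_n, (i < j)%N && (B i j != 0)) ->
    exists l r : ksubset n k -> ksubset n k, transports B l r.
  move=> BN tB dB [i [j /andP[ij Bij]]].
  have [b [c [bc [t t0 [B' [tB' sB' eB]]]]]] := upper_reduction tB dB ij Bij.
  have dB' : \det B' != 0 by apply: contraNneq dB => e; rewrite eB det_mulmx e mul0r.
  have [l [r hB']] := IH B' (leq_trans (proper_card sB') BN) tB' dB'.
  by exists (id \o l), (up bc \o r); rewrite eB; apply/transports_mul/transports_shear.
have [/existsP[i /existsP up]|/existsPn low] :=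
  boolP [exists i : 'I_n, exists j : 'I_n, (i < j)%N && (A i j != 0)].
  by apply: step => //; exists i.
have [/existsP[i /existsP[j /andP[ij Aij]]]|/existsPn upp] :=
  boolP [exists i : 'I_n, exists j : 'I_n, (j < i)%N && (A i j != 0)].
  have [||||l [r h]] := step (rev_mx A).
  - by rewrite card_minor_support_rev.
  - exact: rev_tn.
  - by rewrite /rev_mx det_rev_mx.
  - exists (rev_ord i), (rev_ord j); rewrite mxE !rev_ordK Aij andbT /=.
    by have := ltn_ord i; lia.
  by rewrite -[A]rev_mxK; eexists; eexists; apply: transports_rev h.
have A0 i j : i != j -> A i j = 0.
  rewrite -val_eqE neq_ltn => /orP[ij|ji]; apply/eqP.
    by have /existsPn/(_ j) := low i; rewrite ij negbK.
  by have /existsPn/(_ j) := upp i; rewrite ji negbK.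
have eA : A = diag_mx (\row_i A i i).
  by apply/matrixP => i j; rewrite !mxE; case: eqVneq => [->|/A0].
exists id, id; rewrite eA; apply: transports_diag => i.
rewrite mxE lt_neqAle eq_sym tn_entry // andbT.
apply: contraNneq dA => Aii; rewrite (expand_det_row _ i) big1 // => j _.
by have [<-|/A0->] := eqVneq i j; rewrite ?Aii mul0r.
Qed.

End Factorization.

(** * Minors of powers *)

Section Powers.
Variables (R : realType) (n k : nat).
Implicit Types (A : 'M[R]_n) (I J : ksubset n k).

Lemma interval_support1 : interval_support (1 : 'M[R]_n) (@id (ksubset n k)) id.
Proof.
split=> [I|I J]; first by rewrite !kle_refl.
have [<-|IJ] := eqVneq I J.
  rewrite kle_refl /minor (_ : mxsub _ _ _ = 1%:M) ?det1 ?ltr01 ?ler01 //.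
  apply/matrixP => i j; rewrite !mxE.
  by rewrite (inj_eq (increasing_inj (elem_increasing I))).
have -> : kle I J && kle J I = false.
  by apply/negP => /andP[a b]; case/eqP: IJ; apply: kle_anti.
suff -> : minor I J (1 : 'M[R]_n) = 0 by rewrite lexx ltxx.
have [r rJ] : exists r, elem I r \notin val J.
  apply/existsP; apply: contraNT IJ => /existsPn h; apply/eqP/val_inj/eqP.
  rewrite eqEcard (eqP (valP I)) (eqP (valP J)) leqnn andbT.
  by apply/subsetP => x /in_elem[r <-]; have := h r; rewrite negbK.
rewrite /minor (expand_det_row _ r) big1 // => j _; rewrite !mxE.
by case: eqP => [e|_]; [rewrite e elem_in in rJ | rewrite mul0r].
Qed.

Lemma interval_support_exp A l r m : transports A l r ->
  interval_support (A ^+ m) (fun I => iter m l I) (fun I => iter m r I).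
Proof.
move=> [_ _ _ hA]; elim: m => [|m IH]; first exact: interval_support1.
rewrite exprSr; exact: hA IH.
Qed.

Lemma lambda_interval A l r I : interval_support A l r -> lambda A I = l I.
Proof.
move=> [h1 h2]; rewrite /lambda.
have lr J : kle (l J) (r J) by have /andP[a b] := h1 J; apply: kle_trans a b.
case: pickP => [J /andP[]|/(_ (l I))] /=.
  have [_ ->] := h2 I J => /andP[lJ _] /forallP/(_ (l I)).
  have [_ ->] := h2 I (l I); rewrite kle_refl lr /= => Jl.
  exact: kle_anti.
have [_ ->] := h2 I (l I); rewrite kle_refl lr /= => /negP[].
by apply/forallP => J; have [_ ->] := h2 I J; apply/implyP => /andP[].
Qed.

Lemma rho_interval A l r I : interval_support A l r -> rho A I = r I.
Proof.
move=> [h1 h2]; rewrite /rho.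
have lr J : kle (l J) (r J) by have /andP[a b] := h1 J; apply: kle_trans a b.
case: pickP => [J /andP[]|/(_ (r I))] /=.
  have [_ ->] := h2 I J => /andP[_ Jr] /forallP/(_ (r I)).
  have [_ ->] := h2 I (r I); rewrite kle_refl lr /= => rJ.
  exact: kle_anti.
have [_ ->] := h2 I (r I); rewrite kle_refl lr /= => /negP[].
by apply/forallP => J; have [_ ->] := h2 I J; apply/implyP => /andP[].
Qed.

Lemma oscillatory_det A : oscillatory A -> \det A != 0.
Proof.
move=> [_ [m [m0 tp]]]; apply/eqP => dA.
pose F : ksubset n n := of_increasing (fun i j ij => ij : (id i < id j)%N).
have := tp n F F; rewrite minor_of_increasing (_ : mxsub _ _ _ = A ^+ m).
  by case: m m0 {tp} => // m _; rewrite exprS det_mulmx dA mul0r ltxx.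
by apply/matrixP => i j; rewrite mxE.
Qed.

Lemma minor_exp A : oscillatory A ->
  [/\ forall I, kle (lambda A I) I && kle I (rho A I),
      {homo @lambda R n A k : I J / kle I J}, {homo @rho R n A k : I J / kle I J} &
      forall m I J, (0 < minor I J (A ^+ m)) =
        kle (iter m (@lambda R n A k) I) J && kle J (iter m (@rho R n A k) I)].
Proof.
move=> oA; have dA := oscillatory_det oA; have [tA _] := oA.
have [l [r tlr]] := @transports_tn R n k A tA dA.
have sA := interval_support_exp 1 tlr; rewrite expr1 /= in sA.
have el I : lambda A I = l I := lambda_interval I sA.
have er I : rho A I = r I := rho_interval I sA.
have [h1 h2 h3 _] := tlr; split.
- by move=> I; rewrite el er.
- by move=> I J; rewrite !el; apply: h2.
- by move=> I J; rewrite !er; apply: h3.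
move=> m I J; have [_ /(_ I J)[_ ->]] := interval_support_exp m tlr.
by rewrite (eq_iter el) (eq_iter er).
Qed.

End Powers.

(** * Hitting times *)

Theorem theorem4p2 (R : realType) (n k : nat) (A : 'M[R]_n)
    (hn : (2 <= n)%N) (hA : oscillatory A) (hk1 : (1 <= k)%N) (hkn : (k < n)%N) :
  let Lk := Lset (ltnW hkn) in
  let Rk := Rset (ltnW hkn) in
  exists (e t r l : nat) (h : ksubset n k -> ksubset n k -> nat),
    [/\ is_exponent k A e,
        is_tau (ltnW hkn) A t,
        is_min (fun m => (1 <= m)%N /\ iter m (@rho R n A k) Lk = Rk) r &
        is_min (fun m => (1 <= m)%N /\ iter m (@lambda R n A k) Rk = Lk) l]
    /\ (e = t /\ t = maxn r l)
    /\ (forall I J : ksubset n k,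
          is_min (fun m => 0 < minor I J (A ^+ m)) (h I J) /\
          is_min (fun m => kle (iter m (@lambda R n A k) I) J /\
                           kle J (iter m (@rho R n A k) I)) (h I J))
    /\ (\max_(IJ : ksubset n k * ksubset n k) h IJ.1 IJ.2)%N = e
    /\ (h Lk Rk = e \/ h Rk Lk = e).
Proof.
move=> Lk Rk.
have [bnd lam_homo rho_homo posE] := @minor_exp R n k A hA.
set lam := @lambda R n A k in bnd lam_homo posE *.
set rh := @rho R n A k in bnd rho_homo posE *.
pose pos m (I J : ksubset n k) := 0 < minor I J (A ^+ m).
have LkI I : kle Lk I := Lset_min _ I.
have IRk I : kle I Rk := Rset_max _ I.
have rhoP m : pos m Lk Rk = (iter m rh Lk == Rk).
  rewrite /pos posE IRk /=; apply/idP/eqP => [h|->]; last exact: kle_refl.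
  exact: kle_anti.
have lamP m : pos m Rk Lk = (iter m lam Rk == Lk).
  rewrite /pos posE LkI andbT; apply/idP/eqP => [h|->]; last exact: kle_refl.
  exact: kle_anti.
have posS m I J : pos m I J -> pos m.+1 I J.
  rewrite /pos !posE !iterS => /andP[a b].
  have /andP[c _] := bnd (iter m lam I); have /andP[_ d] := bnd (iter m rh I).
  by rewrite (kle_trans c a) (kle_trans b d).
have pos_mono m m' I J : (m <= m')%N -> pos m I J -> pos m' I J.
  by move/subnK<-; elim: (m' - m)%N => // d IH /IH; apply: posS.
have corners m I J : pos m Lk Rk -> pos m Rk Lk -> pos m I J.
  rewrite rhoP lamP => /eqP eR /eqP eL; rewrite /pos posE.
  have iter_homo f : {homo f : I J / kle I J} -> {homo iter m f : I J / kle I J}.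
    by move=> hf; elim: m {eR eL} => // m IH I' J' IJ; apply/hf/IH.
  apply/andP; split.
    by apply: kle_trans (LkI J); rewrite -eL; apply: iter_homo.
  by apply: (kle_trans (IRk J)); rewrite -eR; apply: iter_homo.
have [N [_ tp]] := hA.2.
have ex I J : exists m, pos m I J by exists N; apply: tp.
pose h I J := ex_minn (ex I J).
have hP I J : is_min (fun m => pos m I J) (h I J).
  by rewrite /h; case: ex_minnP => m pm hm; split.
have LR : Lk != Rk.
  apply/eqP => e; have z : 'I_k := Ordinal hk1.
  have := elem_Lset (ltnW hkn) z; rewrite -/Lk e /Rk Rset_rev elem_rev /= elem_Lset /=.
  by have := ltn_ord z; lia.
have hLR : (1 <= h Lk Rk)%N.
  rewrite lt0n; apply/eqP => e; have [] := hP Lk Rk; rewrite e rhoP /= => /eqP E _.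
  by rewrite E eqxx in LR.
have hRL : (1 <= h Rk Lk)%N.
  rewrite lt0n; apply/eqP => e; have [] := hP Rk Lk; rewrite e lamP /= => /eqP E _.
  by rewrite E eqxx in LR.
set u := h Lk Rk in hLR *; set w := h Rk Lk in hRL *.
have [pu mu] := hP Lk Rk; have [pw mw] := hP Rk Lk.
have pe I J : pos (maxn u w) I J.
  by apply: corners; [apply: pos_mono pu | apply: pos_mono pw]; rewrite ?leq_maxl ?leq_maxr.
exists (maxn u w), (maxn u w), u, w, h; split; [split|split; [|split; [|split]]] => //.
- split; first by rewrite leq_max hLR; split.
  by move=> j [_ hj]; rewrite geq_max mu ?mw //; apply: hj.
- exists u, w; split=> //; split=> // j [_]; [exact: mu | exact: mw].
- split; first by split=> //; apply/eqP; rewrite -rhoP.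
  by move=> j [_ e]; apply: mu; rewrite rhoP e.
- split; first by split=> //; apply/eqP; rewrite -lamP.
  by move=> j [_ e]; apply: mw; rewrite lamP e.
- move=> I J; have [p mp] := hP I J; split; first exact: hP.
  split; first by apply/andP; rewrite -posE.
  by move=> j [a b]; apply: mp; rewrite /pos posE a.
- apply/eqP; rewrite eqn_leq; apply/andP; split.
    by apply/bigmax_leqP => -[I J] _; have [_ ->] := hP I J.
  rewrite geq_max; apply/andP; split.
    exact: (leq_bigmax (Lk, Rk)).
  exact: (leq_bigmax (Rk, Lk)).
- by case: (leqP u w); [right|left].
Qed.
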